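(* Consider the finite-horizon mean-field game with data $(\mathcal S,\mathcal A,T,\mu_0,\{P_t\},\{r_t\})$ described in the context. Suppose that there are constants $C_P>0$, $C_r>0$ such that for every $t\in\mathcal T$ and any two mean-field flows $L^1=\{L^1_t\}_{t\in\mathcal T}$, $L^2=\{L_t^2\}_{t\in\mathcal T}$, $$\max_{s,a}\sum_{s'\in\mathcal S}\big|P_t(s'|s,a,L^1_t)-P_t(s'|s,a,L^2_t)\big|\le C_P\|L^1_t-L^2_t\|_1,\qquad \max_{s,a}\big|r_t(s,a,L_t^1)-r_t(s,a,L_t^2)\big|\le C_r\|L_t^1-L_t^2\|_1 .$$ Let $(y,z,L)$ be a feasible point of (MF-OMO), i.e. $(y,z,L)\in\Theta$, with $f^{\mathrm{MF\text{-}OMO}}(y,z,L)\le\epsilon^2$ for some $\epsilon\ge0$. Then for every $\pi\in\Pi(L)$, $$\mathrm{Expl}(\pi)\le f(S,A,T,C_P,C_r,r_{\max})\,\epsilon+\epsilon^2,$$ where $$ \begin{aligned} f(S,A,T,C_P,C_r,r_{\max}):=\;&T(T+1)r_{\max}\big((C_P+1)^{T+1}-1\big)\sqrt S\\ &+2C_r\frac{(C_P+1)^{T+2}-(T+2)C_P-1}{C_P^2}\sqrt S\\ &+S^{3/2}A(T+2)^3r_{\max}+\sqrt{SA(T+1)}+\sqrt T . \end{aligned} $$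
   Context: **Mean-field game.** $\mathcal S,\mathcal A$ are finite sets with $|\mathcal S|=S$, $|\mathcal A|=A$; $T$ is a finite time horizon and $\mathcal T=\{0,1,\dots,T\}$. For a finite set $X$, $\Delta(X)$ is the set of probability vectors on $X$. $\mu_0\in\Delta(\mathcal S)$ is the initial distribution. For $t\in\mathcal T$, $s\in\mathcal S$, $a\in\mathcal A$ and $\ell\in\Delta(\mathcal S\times\mathcal A)$ there are a transition probability $P_t(\cdot|s,a,\ell)\in\Delta(\mathcal S)$ and a reward $r_t(s,a,\ell)\in\mathbb R$, with $r_{\max}:=\sup_{t,s,a,\ell}|r_t(s,a,\ell)|<\infty$. A policy (sequence) is $\pi=\{\pi_t\}_{t\in\mathcal T}$ with $\pi_t(\cdot|s)\in\Delta(\mathcal A)$; a mean-field flow is $L=\{L_t\}_{t\in\mathcal T}$ with $L_t\in\Delta(\mathcal S\times\mathcal A)$. For a flow $L$, $\mathcal M(L)$ is the MDP with $s_0\sim\mu_0$, $s_{t+1}\sim P_t(\cdot|s_t,a_t,L_t)$ ($0\le t\le T-1$), $a_t\sim\pi_t(\cdot|s_t)$ ($t\in\mathcal T$) and value $V^\pi_{\mu_0}(L)=\mathbb E\big[\sum_{t=0}^T r_t(s_t,a_t,L_t)\big]$ of policy $\pi$; $V^\star_{\mu_0}(L)=\max_{\pi'}V^{\pi'}_{\mu_0}(L)$. **Exploitability.** For a policy $\pi$, the induced flow $\Gamma(\pi)$ is defined by $\Gamma(\pi)_0(s,a)=\mu_0(s)\pi_0(a|s)$ and $\Gamma(\pi)_{t+1}(s,a)=\pi_{t+1}(a|s)\sum_{s',a'}\Gamma(\pi)_t(s',a')P_t(s|s',a',\Gamma(\pi)_t)$,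 $t=0,\dots,T-1$. Then $\mathrm{Expl}(\pi):=V^\star_{\mu_0}(\Gamma(\pi))-V^\pi_{\mu_0}(\Gamma(\pi))$. **The set $\Pi(L)$.** $\pi\in\Pi(L)$ iff $\pi_t(a|s)=L_t(s,a)/\sum_{a'}L_t(s,a')$ whenever $\sum_{a'}L_t(s,a')>0$, and $\pi_t(\cdot|s)$ is an arbitrary element of $\Delta(\mathcal A)$ otherwise. **MF-OMO.** Functions on $\mathcal S\times\mathcal A$ are flattened into vectors in $\mathbb R^{SA}$ in column-major order (state index running fastest), and flows are vectors $L=(L_0,\dots,L_T)\in\mathbb R^{SA(T+1)}$. Let $Z=[I_S,\dots,I_S]\in\mathbb R^{S\times SA}$ ($A$ copies of the identity), and let $W_t(L_t)\in\mathbb R^{S\times SA}$ be the matrix whose row indexed by $s'$ is the flattened vector $P_t(s'|\cdot,\cdot,L_t)$. Then $c_L=(-r_0(\cdot,\cdot,L_0),\dots,-r_T(\cdot,\cdot,L_T))$, $b=(0,\dots,0,\mu_0)\in\mathbb R^{S(T+1)}$, and $A_L\in\mathbb R^{S(T+1)\times SA(T+1)}$ has $T+1$ block rows: for $t=0,\dots,T-1$, block row $t$ has $W_t(L_t)$ in block column $t$, $-Z$ in block column $t+1$ and zeros elsewhere; the last block row has $Z$ in block column $0$ and zeros elsewhere. The problem (MF-OMO) is to minimize $$f^{\mathrm{MF\text{-}OMO}}(y,z,L)=\|A_LL-b\|_2^2+\|A_L^\top y+z-c_L\|_2^2+z^\top L$$ over the feasible set $\Theta$ of all $(y,z,L)\in\mathbb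 R^{S(T+1)}\times\mathbb R^{SA(T+1)}\times\mathbb R^{SA(T+1)}$ with $L\ge0$, $\mathbf 1^\top L_t=1$ for all $t\in\mathcal T$, $z\ge0$, $\mathbf 1^\top z\le SA(T^2+T+2)r_{\max}$, and $\|y\|_2\le \frac{S(T+1)(T+2)}{2}r_{\max}$. Here $\mathbf 1$ is the all-one vector. *)

(* Defs.v *)
From HB Require Import structures.
From mathcomp Require Import all_boot all_order all_algebra.
From mathcomp Require Import boolp classical_sets reals.

Set Implicit Arguments.
Unset Strict Implicit.
Unset Printing Implicit Defensive.

Import Order.TTheory GRing.Theory Num.Theory.

Local Open Scope classical_set_scope.
Local Open Scope ring_scope.

Definition simplex (R : realType) (X : finType) : set {ffun X -> R} :=
  [set p | (forall x, 0 <= p x) /\ \sum_x p x = 1].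
Arguments simplex {R} X.

Definition dist1 (R : realType) (X : finType) (p q : {ffun X -> R}) : R :=
  \sum_x `|p x - q x|.

Definition norm2 (R : realType) (n : nat) (v : 'cV[R]_n) : R :=
  Num.sqrt (\sum_i v i ord0 ^+ 2).

(* The model is only constrained on the simplex: values of [trans] and [reward]
   at functions l outside Delta(S x A) are irrelevant junk.
   [trans t s a l s'] is P_t(s' | s, a, l). *)
Record mfg (R : realType) (S A : finType) (T : nat) := Mfg {
  init : {ffun S -> R};
  trans : 'I_T.+1 -> S -> A -> {ffun S * A -> R} -> {ffun S -> R};
  reward : 'I_T.+1 -> S -> A -> {ffun S * A -> R} -> R;
  init_simplex : simplex S init;
  trans_simplex : forall t s a l,
    simplex (S * A)%type l -> simplex S (trans t s a l);
  reward_bounded :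
    has_ubound [set x | exists t s a l,
      simplex (S * A)%type l /\ x = `|reward t s a l|]
}.

Section MeanFieldGame.
Variables (R : realType) (S A : finType) (T : nat).

Definition is_flow (L : 'I_T.+1 -> {ffun S * A -> R}) : Prop :=
  forall t, simplex (S * A)%type (L t).

Definition is_policy (pi : 'I_T.+1 -> S -> {ffun A -> R}) : Prop :=
  forall t s, simplex A (pi t s).

Variable G : mfg R S A T.

Definition rmax : R :=
  sup [set x | exists t s a l,
    simplex (S * A)%type l /\ x = `|reward G t s a l|].

(* Law of the trajectory (s_0, a_0, ..., s_T, a_T) in the MDP M(L) under pi.
   For t : 'I_T, [widen_ord _ t] is t and [lift ord0 t] is t + 1 in 'I_T.+1. *)
Definition path_prob (pi : 'I_T.+1 -> S -> {ffun A -> R})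
    (L : 'I_T.+1 -> {ffun S * A -> R}) (w : {ffun 'I_T.+1 -> S * A}) : R :=
  init G (w ord0).1
  * (\prod_(t < T.+1) pi t (w t).1 (w t).2)
  * \prod_(t < T)
      (let t0 := widen_ord (leqnSn T) t in
       trans G t0 (w t0).1 (w t0).2 (L t0) (w (lift ord0 t)).1).

Definition value (pi : 'I_T.+1 -> S -> {ffun A -> R})
    (L : 'I_T.+1 -> {ffun S * A -> R}) : R :=
  \sum_(w : {ffun 'I_T.+1 -> S * A})
    path_prob pi L w * \sum_(t < T.+1) reward G t (w t).1 (w t).2 (L t).

Definition opt_value (L : 'I_T.+1 -> {ffun S * A -> R}) : R :=
  sup [set v | exists pi, is_policy pi /\ v = value pi L].

(* [inord n] is n as an element of 'I_T.+1; only n <= T is used below. *)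
Fixpoint induced_rec (pi : 'I_T.+1 -> S -> {ffun A -> R}) (n : nat)
    : {ffun S * A -> R} :=
  match n with
  | 0 => [ffun p => init G p.1 * pi ord0 p.1 p.2]
  | n'.+1 => [ffun p =>
      pi (inord n'.+1) p.1 p.2
      * \sum_q induced_rec pi n' q
                * trans G (inord n') q.1 q.2 (induced_rec pi n') p.1]
  end.

Definition induced_flow (pi : 'I_T.+1 -> S -> {ffun A -> R})
    : 'I_T.+1 -> {ffun S * A -> R} :=
  fun t => induced_rec pi t.

Definition exploitability (pi : 'I_T.+1 -> S -> {ffun A -> R}) : R :=
  opt_value (induced_flow pi) - value pi (induced_flow pi).

(* The set Pi(L). *)
Definition flow_policies (L : 'I_T.+1 -> {ffun S * A -> R})
    : set ('I_T.+1 -> S -> {ffun A -> R}) :=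
  [set pi | is_policy pi /\
    forall t s, 0 < \sum_a' L t (s, a') ->
      forall a, pi t s a = L t (s, a) / \sum_a' L t (s, a')].

(* R^{SA}, R^{S(T+1)} and R^{SA(T+1)} as block columns.  S and A are enumerated
   by [enum_val]; a vector of R^{SA} consists of one block of length |S| for
   each action, i.e. the state index runs fastest. *)
Notation dimSA := (\sum_(a < #|A|) #|S|)%N.
Notation dimST := (\sum_(t < T.+1) #|S|)%N.
Notation dimSAT := (\sum_(t < T.+1) dimSA)%N.

Definition flat (g : S -> A -> R) : 'cV[R]_dimSA :=
  \mxcol_(a < #|A|) \col_(s < #|S|) g (enum_val s) (enum_val a).

Definition time_block (L : 'cV[R]_dimSAT) (t : 'I_T.+1) : 'cV[R]_dimSA :=
  submxcol L t.

Definition unflat (l : 'cV[R]_dimSA) : {ffun S * A -> R} :=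
  [ffun p => (submxcol l (enum_rank p.2) : 'cV[R]_#|S|) (enum_rank p.1) ord0].

Definition flow_of (L : 'cV[R]_dimSAT) : 'I_T.+1 -> {ffun S * A -> R} :=
  fun t => unflat (time_block L t).

Definition Zmx : 'M[R]_(#|S|, dimSA) := \mxrow_(a < #|A|) 1%:M.

Definition Wmx (t : 'I_T.+1) (l : {ffun S * A -> R}) : 'M[R]_(#|S|, dimSA) :=
  \matrix_(s' < #|S|, k < dimSA)
    flat (fun s a => trans G t s a l (enum_val s')) k ord0.

Definition Amx (L : 'I_T.+1 -> {ffun S * A -> R}) : 'M[R]_(dimST, dimSAT) :=
  \mxblock_(t < T.+1, u < T.+1)
    (if t == ord_max then (if u == ord0 then Zmx else 0)
     else if u == t then Wmx t (L t)
     else if u == t.+1 :> nat then - Zmx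
     else 0).

Definition cvec (L : 'I_T.+1 -> {ffun S * A -> R}) : 'cV[R]_dimSAT :=
  \mxcol_(t < T.+1) flat (fun s a => - reward G t s a (L t)).

Definition bvec : 'cV[R]_dimST :=
  \mxcol_(t < T.+1)
    (if t == ord_max then \col_(s < #|S|) init G (enum_val s) else 0).

Definition mfomo_objective (y : 'cV[R]_dimST) (z L : 'cV[R]_dimSAT) : R :=
  norm2 (Amx (flow_of L) *m L - bvec) ^+ 2
  + norm2 ((Amx (flow_of L))^T *m y + z - cvec (flow_of L)) ^+ 2
  + (z^T *m L) ord0 ord0.

(* The set Theta. *)
Definition mfomo_feasible (y : 'cV[R]_dimST) (z L : 'cV[R]_dimSAT) : Prop :=
  [/\ forall i, 0 <= L i ord0,
      forall t, \sum_i time_block L t i ord0 = 1,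
      forall i, 0 <= z i ord0,
      \sum_i z i ord0 <= (#|S| * #|A| * (T ^ 2 + T + 2))%:R * rmax
    & norm2 y <= (#|S| * T.+1 * T.+2)%:R / 2 * rmax].

End MeanFieldGame.

Definition expl_const (R : realType) (S A T : nat) (CP Cr rm : R) : R :=
  T%:R * T.+1%:R * rm * ((CP + 1) ^+ T.+1 - 1) * Num.sqrt S%:R
  + 2 * Cr * (((CP + 1) ^+ T.+2 - T.+2%:R * CP - 1) / CP ^+ 2)
      * Num.sqrt S%:R
  + Num.sqrt S%:R ^+ 3 * A%:R * T.+2%:R ^+ 3 * rm
  + Num.sqrt (S * A * T.+1)%:R
  + Num.sqrt T%:R.

(* Main.v *)
Require Import Defs.
From HB Require Import structures.
From mathcomp Require Import all_boot all_order all_algebra.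
From mathcomp Require Import boolp classical_sets reals.
From mathcomp Require Import ring lra.

(** Write l for the flow encoded by [L], Gamma for the flow induced by [pi], and
    J for the payoff of l against itself ([flow_payoff]).  The three terms of
    the objective are nonnegative, so each residual has Euclidean norm at most
    eps, and z^T L <= eps^2.

    The value of a policy against a fixed flow is linear in its occupation
    measure ([value_occupation]), and the occupation measures of the decision
    process of l are feasible for the linear constraints A_l d = b
    ([occupation_feasible]).  Minimising c_l over these constraints is therefore
    the control problem, (y, z) is an approximate dual solution, and weak
    duality with errors ([lp_gap]) shows that no policy earns much more than J
    against l: the excess is at most |y| eps + eps^2 + eps sqrt(SA(T+1)).

    It remains to pass from l to Gamma.  The rows of A_l l - b say by how much l
    fails to be transported by its own dynamics under [pi]; in each period this
    failure is at most eta = sqrt(S) eps in L1 norm.  The gap between l and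
    Gamma thus satisfies delta (t+1) <= eta + (1 + C_P) delta t
    ([induced_gapS]), and a discrete Gronwall estimate bounds it by
    eta ((1 + C_P)^(t+1) - 1) / C_P ([gronwall_bound]).  Replacing l by Gamma
    changes J into the value of [pi], and the value of a competitor against l
    into its value against Gamma; the Lipschitz hypotheses control both changes
    by the gaps delta.  [exploitability_le_residual] adds up these costs, and
    the summed growth factors give the quotient by C_P^2 ([sum_growth]). *)

Set Implicit Arguments.
Unset Strict Implicit.
Unset Printing Implicit Defensive.

Import Order.TTheory GRing.Theory Num.Theory.

Local Open Scope ring_scope.

(** * Euclidean and L1 norms of finite sums *)

Section FiniteSums.
Variable R : realType.

(** Lagrange's identity: the difference of the two sides is half the sum of
    the squares (f i g j - f j g i)^2. *)
Lemma cauchy_schwarz_sum (I : finType) (f g : I -> R) :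
  (\sum_i f i * g i) ^+ 2 <= (\sum_i f i ^+ 2) * (\sum_i g i ^+ 2).
Proof.
have : 0 <= \sum_i \sum_j (f i * g j - f j * g i) ^+ 2.
  by apply: sumr_ge0 => i _; apply: sumr_ge0 => j _; apply: sqr_ge0.
have -> : \sum_i \sum_j (f i * g j - f j * g i) ^+ 2 =
    2 * ((\sum_i f i ^+ 2) * (\sum_i g i ^+ 2)) - 2 * (\sum_i f i * g i) ^+ 2.
  under eq_bigr => i _.
    have -> : \sum_j (f i * g j - f j * g i) ^+ 2 =
      f i ^+ 2 * (\sum_j g j ^+ 2) + g i ^+ 2 * (\sum_j f j ^+ 2)
      - 2 * (f i * g i) * (\sum_j f j * g j).
      rewrite !mulr_sumr -big_split -sumrB /=.
      by apply: eq_bigr => j _; ring.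
    over.
  by rewrite sumrB big_split /= -!mulr_suml -mulr_sumr; ring.
lra.
Qed.

Lemma norm2_ge0 n (v : 'cV[R]_n) : 0 <= norm2 v.
Proof. exact: sqrtr_ge0. Qed.

Lemma sqr_norm2 n (v : 'cV[R]_n) : norm2 v ^+ 2 = \sum_i v i ord0 ^+ 2.
Proof. by rewrite sqr_sqrtr// sumr_ge0// => i _; apply: sqr_ge0. Qed.

Lemma dot_le_norm2 n (u v : 'cV[R]_n) :
  `|(u^T *m v) ord0 ord0| <= norm2 u * norm2 v.
Proof.
rewrite -(ler_pXn2r (n := 2)) ?nnegrE ?mulr_ge0 ?norm2_ge0//.
rewrite real_normK ?num_real// exprMn !sqr_norm2 mxE.
under eq_bigr do rewrite mxE.
exact: cauchy_schwarz_sum.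
Qed.

(** Cauchy-Schwarz against the constant 1; this is where the factor sqrt |S|
    of the final constant comes from. *)
Lemma l1_le_l2 (I : finType) (f : I -> R) :
  \sum_i `|f i| <= Num.sqrt #|I|%:R * Num.sqrt (\sum_i f i ^+ 2).
Proof.
have sq_ge0 : 0 <= \sum_i f i ^+ 2 by apply: sumr_ge0 => i _; apply: sqr_ge0.
rewrite -(ler_pXn2r (n := 2)) ?nnegrE ?mulr_ge0 ?sqrtr_ge0 ?sumr_ge0//.
rewrite exprMn !sqr_sqrtr//.
have := cauchy_schwarz_sum (fun=> 1) (fun i => `|f i|).
under eq_bigr do rewrite mul1r.
rewrite expr1n sumr_const.
by under [X in _ * X]eq_bigr do rewrite real_normK ?num_real//.
Qed.

End FiniteSums.

(** * Path sums of a time-inhomogeneous Markov chain *)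

Section MarkovPaths.
Variables (R : realType) (X : finType).

Definition ffun_rcons n (w : {ffun 'I_n.+1 -> X}) (x : X) :
    {ffun 'I_n.+2 -> X} :=
  [ffun i => if unlift ord_max i is Some j then w j else x].

Lemma ffun_rconsE n (w : {ffun 'I_n.+1 -> X}) x (i : 'I_n.+2) (j : 'I_n.+1) :
  i = j :> nat -> ffun_rcons w x i = w j.
Proof.
move=> ij; have -> : i = lift ord_max j by apply: ord_inj; rewrite lift_max.
by rewrite ffunE liftK.
Qed.

Lemma ffun_rcons_max n (w : {ffun 'I_n.+1 -> X}) x :
  ffun_rcons w x ord_max = x.
Proof. by rewrite ffunE unlift_none. Qed.

(** Splitting off the last state of a path is what turns sums over paths into
    inductions on the horizon. *)
Lemma sum_ffun_rcons n (F : {ffun 'I_n.+2 -> X} -> R) :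
  \sum_w F w = \sum_(w : {ffun 'I_n.+1 -> X}) \sum_x F (ffun_rcons w x).
Proof.
rewrite pair_big /=.
apply: (reindex (fun p : {ffun 'I_n.+1 -> X} * X => ffun_rcons p.1 p.2)).
exists (fun w : {ffun 'I_n.+2 -> X} =>
  ([ffun i : 'I_n.+1 => w (lift ord_max i)], w ord_max)) => /=.
  move=> [w x] _ /=; rewrite ffun_rcons_max; congr pair.
  by apply/ffunP => i; rewrite ffunE (ffun_rconsE _ _ (j := i)) ?lift_max.
move=> w _; apply/ffunP => i; rewrite ffunE.
by case: unliftP => [j ->|->]; rewrite ?ffunE.
Qed.

Variables (q : X -> R) (K : nat -> X -> X -> R).

Definition path_weight n (w : {ffun 'I_n.+1 -> X}) : R :=
  q (w ord0)
  * \prod_(t < n) K t (w (widen_ord (leqnSn n) t)) (w (lift ord0 t)).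

Fixpoint chain_law n : X -> R :=
  if n is m.+1 then fun y => \sum_x chain_law m x * K m x y else q.

Lemma path_weight_rcons n (w : {ffun 'I_n.+1 -> X}) x :
  path_weight (ffun_rcons w x) = path_weight w * K n (w ord_max) x.
Proof.
rewrite /path_weight big_ord_recr /= mulrA (ffun_rconsE _ _ (j := ord0))//.
congr (_ * _ * _).
  apply: eq_bigr => t _.
  rewrite (ffun_rconsE _ _ (j := widen_ord (leqnSn n) t))//.
  by rewrite (ffun_rconsE _ _ (j := lift ord0 t)).
rewrite (ffun_rconsE _ _ (j := ord_max))//.
by rewrite (_ : lift ord0 ord_max = ord_max) ?ffun_rcons_max//; apply: val_inj.
Qed.

(** Summing out the states one by one is a Chapman-Kolmogorov recursion. *)
Lemma sum_path_last n (h : X -> R) :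
  \sum_(w : {ffun 'I_n.+1 -> X}) path_weight w * h (w ord_max)
  = \sum_x chain_law n x * h x.
Proof.
elim: n h => [|n IH] h /=.
  rewrite (reindex (fun x : X => [ffun _ : 'I_1 => x])) /=; last first.
    exists (fun w : {ffun 'I_1 -> X} => w ord0) => [x _|w _]; rewrite ?ffunE//.
    by apply/ffunP => i; rewrite ffunE (ord1 i).
  by apply: eq_bigr => x _; rewrite /path_weight big_ord0 mulr1 !ffunE.
rewrite sum_ffun_rcons.
transitivity (\sum_(w : {ffun 'I_n.+1 -> X})
    path_weight w * \sum_x K n (w ord_max) x * h x).
  apply: eq_bigr => w _; rewrite mulr_sumr; apply: eq_bigr => x _.
  by rewrite path_weight_rcons ffun_rcons_max mulrA.
rewrite (IH (fun y => \sum_x K n y x * h x)).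
under [LHS]eq_bigr do rewrite mulr_sumr.
rewrite exchange_big /=; apply: eq_bigr => x _; rewrite mulr_suml.
by apply: eq_bigr => y _; rewrite mulrA.
Qed.

Hypothesis K1 : forall t x, \sum_y K t x y = 1.

(** An additive functional only sees the one-time marginals: the cost at time
    n + 1 is read off by [sum_path_last], and in all earlier costs the last
    state integrates to 1. *)
Lemma sum_path_additive n (f : nat -> X -> R) :
  \sum_(w : {ffun 'I_n.+1 -> X}) path_weight w * \sum_(t < n.+1) f t (w t)
  = \sum_(t < n.+1) \sum_x chain_law t x * f t x.
Proof.
elim: n => [|n IH].
  rewrite big_ord_recl big_ord0 addr0 -[RHS](sum_path_last 0 (f 0)).
  apply: eq_bigr => w _; rewrite big_ord_recl big_ord0 addr0.
  by congr (_ * f 0 (w _)); apply: val_inj.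
rewrite big_ord_recr /= -IH -(sum_path_last n.+1 (f n.+1)).
under [LHS]eq_bigr do rewrite big_ord_recr /= mulrDr.
rewrite big_split /=; congr (_ + _); rewrite sum_ffun_rcons.
apply: eq_bigr => w _; rewrite -[RHS]mulr1 -(K1 n (w ord_max)) mulr_sumr.
apply: eq_bigr => x _; rewrite path_weight_rcons mulrAC; congr (_ * _ * _).
by apply: eq_bigr => t _; rewrite (ffun_rconsE _ _ (j := t)).
Qed.

End MarkovPaths.

(** * Probability vectors and their L1 distance *)

Lemma simplex_ge0 (R : realType) (X : finType) (p : {ffun X -> R}) x :
  simplex X p -> 0 <= p x.
Proof. by case. Qed.

Lemma simplex_sum (R : realType) (X : finType) (p : {ffun X -> R}) :
  simplex X p -> \sum_x p x = 1.
Proof. by case. Qed.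

Lemma simplex_inhabited (R : realType) (X : finType) (p : {ffun X -> R}) :
  simplex X p -> exists x, p x != 0.
Proof.
move=> pP; have [x px|p0] := pickP (fun x => p x != 0); first by exists x.
have := simplex_sum pP; rewrite big1 => [/eqP|x _]; last first.
  by apply/eqP; rewrite -[_ == _]negbK (p0 x).
by rewrite eq_sym oner_eq0.
Qed.

Lemma simplex_le1 (R : realType) (X : finType) (p : {ffun X -> R}) x :
  simplex X p -> p x <= 1.
Proof.
move=> [p_ge0 <-]; rewrite (bigD1 x)//= lerDl.
by apply: sumr_ge0 => y _.
Qed.

Lemma simplex_mean_le (R : realType) (X : finType) (p : {ffun X -> R})
    (f : X -> R) c :
  simplex X p -> (forall x, f x <= c) -> \sum_x p x * f x <= c.
Proof.
move=> pP fc; rewrite -[leRHS]mul1r -(simplex_sum pP) mulr_suml.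
by apply: ler_sum => x _; apply: ler_wpM2l (fc x); apply: simplex_ge0.
Qed.

Lemma dist1C (R : realType) (X : finType) (p q : {ffun X -> R}) :
  dist1 p q = dist1 q p.
Proof. by apply: eq_bigr => x _; rewrite distrC. Qed.

Lemma dist1_triangle (R : realType) (X : finType) (p q r : {ffun X -> R}) :
  dist1 p r <= dist1 p q + dist1 q r.
Proof. by rewrite -big_split; apply: ler_sum => x _; apply: ler_distD. Qed.

(** Write p1 K1 - p2 K2 = (p1 - p2) K1 + p2 (K1 - K2): pushing forward by the
    stochastic kernel [K1] does not increase the L1 norm, and the second term
    is an average of rows that are [c]-close. *)
Lemma dist1_mixture (R : realType) (X Y : finType) (p1 p2 : {ffun X -> R})
    (K1 K2 : X -> {ffun Y -> R}) c :
  simplex X p2 -> (forall x, simplex Y (K1 x)) ->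
  (forall x, dist1 (K1 x) (K2 x) <= c) ->
  \sum_y `|\sum_x p1 x * K1 x y - \sum_x p2 x * K2 x y| <= dist1 p1 p2 + c.
Proof.
move=> p2P K1P K12.
apply: (@le_trans _ _ (\sum_y \sum_x
    (`|p1 x - p2 x| * K1 x y + p2 x * `|K1 x y - K2 x y|))).
  apply: ler_sum => y _; rewrite -sumrB; apply: le_trans (ler_norm_sum _ _ _) _.
  apply: ler_sum => x _.
  have -> : p1 x * K1 x y - p2 x * K2 x y =
    (p1 x - p2 x) * K1 x y + p2 x * (K1 x y - K2 x y) by ring.
  apply: le_trans (ler_normD _ _) _; rewrite !normrM.
  rewrite (ger0_norm (simplex_ge0 _ (K1P x))).
  by rewrite (ger0_norm (simplex_ge0 _ p2P)).
rewrite exchange_big /=.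
under eq_bigr => x _ do
  rewrite big_split /= -!mulr_sumr (simplex_sum (K1P x)) mulr1.
by rewrite big_split /= lerD2l; apply: simplex_mean_le.
Qed.

(** * Occupation measures of the decision process and of the induced flow *)

Section Occupation.
Variables (R : realType) (S A : finType) (T : nat) (G : mfg R S A T).
Implicit Types (pi : 'I_T.+1 -> S -> {ffun A -> R}).
Implicit Types (L : 'I_T.+1 -> {ffun S * A -> R}).

Definition mass (l : {ffun S * A -> R}) s := \sum_a l (s, a).

Lemma sum_policy pi t (m : S -> R) : is_policy pi ->
  \sum_p pi t p.1 p.2 * m p.1 = \sum_s m s.
Proof.
move=> piP; rewrite -(pair_bigA _ (fun s a => pi t s a * m s)) /=.
by apply: eq_bigr => s _; rewrite -mulr_suml (simplex_sum (piP t s)) mul1r.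
Qed.

(** Extending state measures by a common policy is an L1 isometry, so flows
    obtained from the same policy may be compared through their states. *)
Lemma dist1_policy pi t (m1 m2 : S -> R) : is_policy pi ->
  dist1 [ffun p => pi t p.1 p.2 * m1 p.1] [ffun p => pi t p.1 p.2 * m2 p.1]
  = \sum_s `|m1 s - m2 s|.
Proof.
move=> piP; rewrite -(sum_policy t _ piP); apply: eq_bigr => p _.
by rewrite !ffunE -mulrBr normrM ger0_norm// (simplex_ge0 _ (piP t _)).
Qed.

(** The mean field [Ln] is kept apart from the law [l] of (s_n, a_n), so that
    one recursion serves both the decision process of a fixed flow and the
    induced flow, for which the two coincide. *)
Definition next_law pi n (Ln l : {ffun S * A -> R}) : {ffun S * A -> R} :=
  [ffun p => pi (inord n.+1) p.1 p.2
             * \sum_q l q * trans G (inord n) q.1 q.2 Ln p.1].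

Fixpoint occupation pi L n : {ffun S * A -> R} :=
  if n is m.+1 then next_law pi m (L (inord m)) (occupation pi L m)
  else [ffun p => pi ord0 p.1 p.2 * init G p.1].

Lemma next_law_simplex pi n Ln l : is_policy pi ->
  simplex (S * A)%type Ln -> simplex (S * A)%type l ->
  simplex (S * A)%type (next_law pi n Ln l).
Proof.
move=> piP LnP lP; have KP q := trans_simplex G (inord n) q.1 q.2 LnP.
split=> [p|].
  rewrite ffunE mulr_ge0 ?(simplex_ge0 _ (piP _ _))// sumr_ge0// => q _.
  by rewrite mulr_ge0 ?(simplex_ge0 _ lP)// (simplex_ge0 _ (KP q)).
under eq_bigr do rewrite ffunE.
rewrite (sum_policy _ (fun s => \sum_q l q * trans G _ q.1 q.2 Ln s) piP).
rewrite exchange_big /=.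
under eq_bigr => q _ do rewrite -mulr_sumr (simplex_sum (KP q)) mulr1.
exact: simplex_sum lP.
Qed.

Lemma initial_law_simplex pi : is_policy pi ->
  simplex (S * A)%type [ffun p => pi ord0 p.1 p.2 * init G p.1].
Proof.
move=> piP; split=> [p|].
  rewrite ffunE mulr_ge0 ?(simplex_ge0 _ (piP _ _))//.
  exact: simplex_ge0 (init_simplex G).
under eq_bigr do rewrite ffunE.
by rewrite (sum_policy _ (init G)) // (simplex_sum (init_simplex G)).
Qed.

Lemma occupation_simplex pi L n : is_policy pi -> is_flow L ->
  simplex (S * A)%type (occupation pi L n).
Proof.
move=> piP LP; elim: n => [|n IH] /=; first exact: initial_law_simplex.
by apply: next_law_simplex.
Qed.

Lemma induced_rec0 pi :
  induced_rec G pi 0 = [ffun p => pi ord0 p.1 p.2 * init G p.1].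
Proof. by apply/ffunP => p; rewrite !ffunE mulrC. Qed.

Lemma induced_recS pi n :
  induced_rec G pi n.+1 =
  next_law pi n (induced_rec G pi n) (induced_rec G pi n).
Proof. by []. Qed.

Lemma induced_simplex pi n : is_policy pi ->
  simplex (S * A)%type (induced_rec G pi n).
Proof.
move=> piP; elim: n => [|n IH].
  by rewrite induced_rec0; apply: initial_law_simplex.
by rewrite induced_recS; apply: next_law_simplex.
Qed.

(** The induced flow is the fixed point of consistency: [pi] played against it
    reproduces it. *)
Lemma occupation_induced pi n : (n <= T)%N ->
  occupation pi (induced_flow G pi) n = induced_rec G pi n.
Proof.
elim: n => [|n IH] nT; first by rewrite induced_rec0.
have nT' := ltnW nT.
have -> : occupation pi (induced_flow G pi) n.+1 =
  next_law pi n (induced_flow G pi (inord n)) (induced_rec G pi n).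
  by rewrite -(IH nT').
by rewrite induced_recS /induced_flow (inordK nT').
Qed.

(** State-action pairs form a Markov chain under [pi], and the return is an
    additive functional of it; so the value is linear in the occupation
    measure. *)
Lemma value_occupation pi L : is_policy pi -> is_flow L ->
  value G pi L =
  \sum_(t < T.+1) \sum_p occupation pi L t p * reward G t p.1 p.2 (L t).
Proof.
move=> piP LP.
pose q (p : S * A) := pi ord0 p.1 p.2 * init G p.1.
pose K n (x y : S * A) := pi (inord n.+1) y.1 y.2
  * trans G (inord n) x.1 x.2 (L (inord n)) y.1.
pose f n (p : S * A) := reward G (inord n) p.1 p.2 (L (inord n)).
have lawE n p : chain_law q K n p = occupation pi L n p.
  elim: n p => [|n IH] p /=; rewrite ffunE// mulr_sumr.
  by apply: eq_bigr => x _; rewrite IH mulrCA.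
have K1 n x : \sum_y K n x y = 1.
  rewrite (sum_policy _ (trans G (inord n) x.1 x.2 (L (inord n))) piP).
  exact: simplex_sum (trans_simplex _ _ _ _ (LP _)).
transitivity (\sum_(w : {ffun 'I_T.+1 -> S * A})
    path_weight q K w * \sum_(t < T.+1) f t (w t)).
  apply: eq_bigr => w _; congr (_ * _); last first.
    by apply: eq_bigr => t _; rewrite /f inord_val.
  rewrite /path_prob /path_weight big_ord_recl big_split /= -!mulrA [LHS]mulrCA.
  congr (_ * (_ * (_ * _))); apply: eq_bigr => t _.
    rewrite (_ : inord t.+1 = lift ord0 t)//.
    by apply: val_inj; rewrite /= inordK// ltnS.
  rewrite (_ : inord t = widen_ord (leqnSn T) t)//.
  by apply: val_inj; rewrite /= inordK// ltnS ltnW.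
rewrite (sum_path_additive _ K1); apply: eq_bigr => t _; apply: eq_bigr => p _.
by rewrite lawE /f inord_val.
Qed.

Lemma reward_le_rmax t s a l :
  simplex (S * A)%type l -> `|reward G t s a l| <= rmax G.
Proof.
by move=> lP; apply: (ub_le_sup (reward_bounded G)); exists t, s, a, l.
Qed.

(** Also true at states without mass: there all the [L t (s, a)] vanish, and
    the arbitrary choice of [pi t s] is multiplied by 0. *)
Lemma flow_policyE pi L t : is_flow L -> flow_policies L pi ->
  L t = [ffun p => pi t p.1 p.2 * mass (L t) p.1].
Proof.
move=> LP [_ piL]; apply/ffunP => -[s a]; rewrite ffunE /=.
have m_ge0 : 0 <= mass (L t) s.
  by apply: sumr_ge0 => a' _; apply: simplex_ge0.
have [m_gt0|] := ltP 0 (mass (L t) s).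
  by rewrite piL// divfK// gt_eqF.
move=> m_le0; have m0 : mass (L t) s = 0 by apply/eqP; rewrite eq_le m_le0.
rewrite m0 mulr0.
have /psumr_eq0P -> // : mass (L t) s = 0 by [].
by move=> a' _; apply: simplex_ge0.
Qed.

(** The violation of flow conservation between times n and n + 1; it is the
    block n of [Amx L *m L - bvec] by [constraint_step]. *)
Definition residual L n s : R :=
  \sum_q L (inord n) q * trans G (inord n) q.1 q.2 (L (inord n)) s
  - mass (L (inord n.+1)) s.

Lemma induced_gap0 pi L : is_flow L -> flow_policies L pi ->
  dist1 (L ord0) (induced_rec G pi 0) = \sum_s `|mass (L ord0) s - init G s|.
Proof.
move=> LP piL; rewrite induced_rec0 {1}(flow_policyE ord0 LP piL).
by rewrite dist1_policy//; case: piL.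
Qed.

(** The reward that [L] would earn if it were its own occupation measure; it is
    minus the linear objective [cvec] of the program at [L]. *)
Definition flow_payoff (L : 'I_T.+1 -> {ffun S * A -> R}) : R :=
  \sum_t \sum_p L t p * reward G t p.1 p.2 (L t).

Lemma rmax_ge0 (l : {ffun S * A -> R}) :
  simplex (S * A)%type l -> 0 <= rmax G.
Proof.
move=> lP; have [[s a] _] := simplex_inhabited lP.
exact: le_trans (normr_ge0 _) (reward_le_rmax ord0 s a lP).
Qed.

Section Lipschitz.
Variables (C_P C_r : R).
Hypothesis trans_lip : forall t s a l1 l2,
  simplex (S * A)%type l1 -> simplex (S * A)%type l2 ->
  dist1 (trans G t s a l1) (trans G t s a l2) <= C_P * dist1 l1 l2.
Hypothesis reward_lip : forall t s a l1 l2,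
  simplex (S * A)%type l1 -> simplex (S * A)%type l2 ->
  `|reward G t s a l1 - reward G t s a l2| <= C_r * dist1 l1 l2.

Lemma dist1_next_law pi n m1 m2 l1 l2 : is_policy pi ->
  simplex (S * A)%type m1 -> simplex (S * A)%type m2 ->
  simplex (S * A)%type l2 ->
  dist1 (next_law pi n m1 l1) (next_law pi n m2 l2)
  <= dist1 l1 l2 + C_P * dist1 m1 m2.
Proof.
move=> piP m1P m2P l2P.
rewrite (dist1_policy _
  (fun s => \sum_q l1 q * trans G (inord n) q.1 q.2 m1 s)
  (fun s => \sum_q l2 q * trans G (inord n) q.1 q.2 m2 s) piP).
apply: (dist1_mixture _ (K1 := fun q => trans G (inord n) q.1 q.2 m1)
  (K2 := fun q => trans G (inord n) q.1 q.2 m2)) => // q.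
  exact: trans_simplex.
exact: trans_lip.
Qed.

(** Change first the mean field inside the reward, then the weights. *)
Lemma expected_reward_gap t (d1 d2 l1 l2 : {ffun S * A -> R}) :
  simplex (S * A)%type d1 ->
  simplex (S * A)%type l1 -> simplex (S * A)%type l2 ->
  \sum_p d1 p * reward G t p.1 p.2 l1 - \sum_p d2 p * reward G t p.1 p.2 l2
  <= C_r * dist1 l1 l2 + rmax G * dist1 d1 d2.
Proof.
move=> d1P l1P l2P; rewrite -sumrB.
have -> : \sum_p (d1 p * reward G t p.1 p.2 l1 - d2 p * reward G t p.1 p.2 l2)
  = \sum_p d1 p * (reward G t p.1 p.2 l1 - reward G t p.1 p.2 l2)
    + \sum_p (d1 p - d2 p) * reward G t p.1 p.2 l2.
  by rewrite -big_split; apply: eq_bigr => p _ /=; ring.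
apply: lerD.
  apply: simplex_mean_le => // p.
  exact: le_trans (ler_norm _) (reward_lip _ _ _ _ _).
rewrite mulr_sumr; apply: ler_sum => p _.
apply: le_trans (ler_norm _) _; rewrite normrM mulrC.
by apply: ler_wpM2r => //; apply: reward_le_rmax.
Qed.

(** A fixed policy against two mean-field flows: the occupation measures drift
    apart only through the transition kernels, hence additively in time. *)
Lemma occupation_drift pi L1 L2 n : is_policy pi -> is_flow L1 -> is_flow L2 ->
  dist1 (occupation pi L1 n.+1) (occupation pi L2 n.+1)
  <= dist1 (occupation pi L1 n) (occupation pi L2 n)
     + C_P * dist1 (L1 (inord n)) (L2 (inord n)).
Proof.
move=> piP L1P L2P.
by apply: dist1_next_law => //; apply: occupation_simplex.
Qed.

(** Compare [L] at time n + 1 with the one-step image of [L] at time n: this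
    costs the residual.  That image and the next induced law differ by the
    present gap (propagated by the dynamics) plus [C_P] times it (the kernels
    depend on the mean field). *)
Lemma induced_gapS pi L n : is_flow L -> flow_policies L pi ->
  dist1 (L (inord n.+1)) (induced_rec G pi n.+1)
  <= \sum_s `|residual L n s|
     + (dist1 (L (inord n)) (induced_rec G pi n)
        + C_P * dist1 (L (inord n)) (induced_rec G pi n)).
Proof.
move=> LP piL; have piP : is_policy pi by case: piL.
apply: le_trans (dist1_triangle _
  (next_law pi n (L (inord n)) (L (inord n))) _) (lerD _ _); last first.
  by rewrite induced_recS; apply: dist1_next_law => //; apply: induced_simplex.
rewrite {1}(flow_policyE (inord n.+1) LP piL) (dist1_policy _ _
  (fun s => \sum_q L _ q * trans G (inord n) q.1 q.2 (L (inord n)) s) piP).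
by apply: ler_sum => s _; rewrite distrC.
Qed.

End Lipschitz.
End Occupation.

(** * Discrete Gronwall estimates *)

Section Growth.
Variables (R : realType) (C : R).
Hypothesis C_gt0 : 0 < C.

(** This is 1 + (1 + C) + ... + (1 + C)^n, the accumulation factor of a unit
    error made at every step. *)
Definition growth n : R := ((C + 1) ^+ n.+1 - 1) / C.

Let C_neq0 : C != 0. Proof. by rewrite gt_eqF. Qed.

Lemma growth0 : growth 0 = 1.
Proof. by rewrite /growth expr1 addrK divff. Qed.

Lemma growthS n : growth n.+1 = 1 + (C + 1) * growth n.
Proof. by rewrite /growth [in LHS]exprS; field. Qed.

Lemma growth_ge0 n : 0 <= growth n.
Proof.
elim: n => [|n IH]; first by rewrite growth0.
by rewrite growthS addr_ge0// mulr_ge0// addr_ge0// ltW.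
Qed.

Lemma growth_le n m : (n <= m)%N -> growth n <= growth m.
Proof.
elim: m => [|m IH]; first by rewrite leqn0 => /eqP ->.
rewrite leq_eqVlt => /predU1P[-> //|/IH nm]; apply: le_trans nm _.
have := mulr_ge0 (ltW C_gt0) (growth_ge0 m).
by rewrite growthS; nra.
Qed.

Lemma sum_growth n :
  \sum_(t < n) growth t = ((C + 1) ^+ n.+1 - n.+1%:R * C - 1) / C ^+ 2.
Proof.
elim: n => [|n IH].
  by rewrite big_ord0 expr1 mul1r; field.
rewrite big_ord_recr /= IH /growth [in RHS]exprS.
by rewrite -!natr1; field.
Qed.

Lemma gronwall_bound T eta (u : nat -> R) :
  0 <= eta -> u 0 <= eta ->
  (forall n, (n < T)%N -> u n.+1 <= eta + (u n + C * u n)) ->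
  forall n, (n <= T)%N -> u n <= eta * growth n.
Proof.
move=> eta_ge0 u0 uS; elim=> [|n IH] nT; first by rewrite growth0 mulr1.
have := ler_wpM2l (ltW C_gt0) (IH (ltnW nT)); have := IH (ltnW nT).
by have := uS n nT; rewrite growthS; nra.
Qed.

End Growth.

Lemma increment_bound (R : realType) T a b (u : nat -> R) :
  u 0 <= a -> (forall n, (n < T)%N -> u n.+1 <= u n + b) ->
  forall n, (n <= T)%N -> u n <= a + n%:R * b.
Proof.
move=> u0 uS; elim=> [|n IH] nT; first by rewrite mul0r addr0.
have := IH (ltnW nT); have := uS n nT; rewrite -natr1; nra.
Qed.

Lemma sum_ord_nat (R : realType) n :
  \sum_(t < n.+1) (t%:R : R) = n%:R * n.+1%:R / 2.
Proof.
elim: n => [|n IH]; first by rewrite big_ord_recl big_ord0 !mul0r addr0.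
by rewrite big_ord_recr /= IH -!natr1; field.
Qed.

(** * From flow residuals to exploitability *)

Section Exploitability.
Variables (R : realType) (S A : finType) (T : nat) (G : mfg R S A T).
Variables (C_P C_r : R).
Hypothesis C_P_gt0 : 0 < C_P.
Hypothesis C_r_gt0 : 0 < C_r.
Hypothesis trans_lip : forall t s a l1 l2,
  simplex (S * A)%type l1 -> simplex (S * A)%type l2 ->
  dist1 (trans G t s a l1) (trans G t s a l2) <= C_P * dist1 l1 l2.
Hypothesis reward_lip : forall t s a l1 l2,
  simplex (S * A)%type l1 -> simplex (S * A)%type l2 ->
  `|reward G t s a l1 - reward G t s a l2| <= C_r * dist1 l1 l2.

(** For a competitor [pi'], with Gamma the flow induced by [pi], telescope
      value pi' Gamma - value pi Gamma
        = (value pi' Gamma - value pi' L) + (value pi' L - flow_payoff L)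
          + (flow_payoff L - value pi Gamma).
    With delta t the L1 gap between [L t] and Gamma t, the outer brackets cost
    [C_r] * delta t each for the rewards, plus [rmax G] times a gap of weights:
    at most t * C_P * max delta in the first bracket and delta t in the last.
    There delta t is bounded by (t + 1) * eta + t * C_P * max delta instead of
    its exponential bound, so that the two brackets share equally the
    T (T + 1) * C_P * growth C_P T of the conclusion. *)
Lemma exploitability_le_residual L pi (eta kappa : R) :
  is_flow L -> flow_policies L pi -> 0 <= eta ->
  \sum_s `|mass (L ord0) s - init G s| <= eta ->
  (forall n, (n < T)%N -> \sum_s `|residual G L n s| <= eta) ->
  (forall pi', is_policy pi' -> value G pi' L - flow_payoff G L <= kappa) ->
  exploitability G pi <=
    2 * C_r * eta * \sum_(t < T.+1) growth C_P t
    + rmax G * eta * (T%:R * T.+1%:R * (C_P * growth C_P T)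
                      + T.+1%:R * T.+2%:R / 2)
    + kappa.
Proof.
move=> LP piL eta_ge0 res0 resS kappaP.
have piP : is_policy pi by case: piL.
have r_ge0 := rmax_ge0 G (LP ord0).
set Gm := induced_flow G pi.
have GP : is_flow Gm by move=> t; apply: induced_simplex.
pose delta n := dist1 (L (inord n)) (induced_rec G pi n).
pose b := C_P * (eta * growth C_P T).
have delta0 : delta 0 <= eta.
  rewrite /delta (_ : inord 0 = ord0) ?induced_gap0//.
  by apply: val_inj; rewrite /= inordK.
have deltaS n : (n < T)%N -> delta n.+1 <= eta + (delta n + C_P * delta n).
  move=> nT; apply: le_trans (induced_gapS trans_lip n LP piL) _.
  by rewrite lerD2r resS.
have delta_growth := gronwall_bound C_P_gt0 eta_ge0 delta0 deltaS.
have delta_b n : (n <= T)%N -> C_P * delta n <= b.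
  move=> nT; apply: (ler_wpM2l (ltW C_P_gt0)).
  apply: le_trans (delta_growth n nT) _.
  by apply: (ler_wpM2l eta_ge0); apply: growth_le.
(* b bounds C_P * delta, so each step of the recursion adds at most eta + b *)
have delta_lin n : (n <= T)%N -> delta n <= eta + n%:R * (eta + b).
  apply: increment_bound => // m mT.
  by have := deltaS m mT; have := delta_b m (ltnW mT); lra.
have deltaE t : dist1 (L t) (Gm t) = delta t by rewrite /delta inord_val.
have GmE n : (n <= T)%N -> Gm (inord n) = induced_rec G pi n.
  by move=> nT; rewrite /Gm /induced_flow (inordK nT).
have sum_t := sum_ord_nat R T.
have sum_delta : \sum_(t < T.+1) delta t <= eta * \sum_(t < T.+1) growth C_P t.
  rewrite mulr_sumr; apply: ler_sum => t _.
  by apply: delta_growth; rewrite -ltnS.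
have sum_delta_lin : \sum_(t < T.+1) delta t <=
    eta * (T.+1%:R * T.+2%:R / 2) + T%:R * T.+1%:R / 2 * b.
  apply: (@le_trans _ _ (\sum_(t < T.+1) (eta + t%:R * (eta + b)))).
    by apply: ler_sum => t _; apply: delta_lin; rewrite -ltnS.
  rewrite big_split /= -mulr_suml sum_t sumr_const card_ord.
  rewrite -[eta *+ _]mulr_natr.
  by rewrite -(natr1 T.+1) -(natr1 T); lra.
have gain_pi : flow_payoff G L - value G pi Gm <=
    C_r * (\sum_(t < T.+1) delta t) + rmax G * \sum_(t < T.+1) delta t.
  rewrite value_occupation// -sumrB !mulr_sumr -big_split /=.
  apply: ler_sum => t _; rewrite -(deltaE t).
  have tT : (t <= T)%N by rewrite -ltnS.
  rewrite (occupation_induced G pi tT : occupation G pi Gm t = Gm t).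
  exact: (expected_reward_gap reward_lip t (Gm t) (LP t) (LP t) (GP t)).
have gain_pi' pi' : is_policy pi' -> value G pi' Gm - value G pi' L <=
    C_r * (\sum_(t < T.+1) delta t) + rmax G * (T%:R * T.+1%:R / 2 * b).
  move=> pi'P; rewrite !value_occupation// -sumrB -sum_t.
  rewrite mulr_suml !mulr_sumr -big_split /=; apply: ler_sum => t _.
  apply: le_trans (expected_reward_gap reward_lip t _ _ _ _) _; rewrite ?GP//.
    exact: occupation_simplex.
  rewrite dist1C deltaE lerD2l; apply: (ler_wpM2l r_ge0).
  rewrite -[leRHS]add0r; move: (ltn_ord t); rewrite ltnS; move: (t : nat).
  apply: increment_bound => [|n nT].
    by rewrite /dist1 big1// => p _; rewrite subrr normr0.
  apply: le_trans (occupation_drift trans_lip n pi'P GP LP) _.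
  by rewrite lerD2l dist1C GmE ?delta_b// ltnW.
rewrite /exploitability lerBlDr; apply: ge_sup.
  by exists (value G pi Gm), pi.
move=> _ [pi' [pi'P ->]]; have := gain_pi' pi' pi'P; have := kappaP pi' pi'P.
have := ler_wpM2l (ltW C_r_gt0) sum_delta.
have := ler_wpM2l r_ge0 sum_delta_lin.
move: gain_pi; rewrite -/Gm /b.
lra.
Qed.

End Exploitability.

(** * Duality gap of the linear program and its block coordinates *)

Lemma sum_Rank (R : realType) n (p_ : 'I_n -> nat)
    (F : 'I_(\sum_i p_ i)%N -> R) :
  \sum_k F k = \sum_i \sum_j F (tagnat.Rank i j).
Proof.
rewrite sig_big_dep /= (reindex _ tagnat.rank_bij_on) /=.
by apply: eq_bigr => i _; rewrite tagnat.rankE.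
Qed.

Lemma mxcol_Rank (R : realType) n (p_ : 'I_n -> nat) m
    (B : forall i, 'M[R]_(p_ i, m)) i j k :
  (\mxcol_i B i) (tagnat.Rank i j) k = B i j k.
Proof. by rewrite -[in RHS](mxcolK B i) [RHS]mxE. Qed.

Lemma mxrow_Rank (R : realType) n (q_ : 'I_n -> nat) m
    (B : forall j, 'M[R]_(m, q_ j)) i j k :
  (\mxrow_j B j) i (tagnat.Rank j k) = B j i k.
Proof. by rewrite -[in RHS](mxrowK B j) [RHS]mxE. Qed.

Lemma sum_enum_rank (R : realType) (X : finType) (F : 'I_#|X| -> R) :
  \sum_i F i = \sum_x F (enum_rank x).
Proof. by rewrite (reindex _ (onW_bij _ (@enum_rank_bij X))). Qed.

(** Weak duality with errors.  If [d] is primal feasible and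
    g = M^T y + z - c is the dual residual, then
      c (x - d) = y (M x - b) + z x - z d - g (x - d),
    where z d >= 0 by nonnegativity and the two residual terms obey
    Cauchy-Schwarz. *)
Lemma lp_gap (R : realType) m n (M : 'M[R]_(m, n)) (b y : 'cV[R]_m)
    (c x d z : 'cV[R]_n) :
  M *m d = b -> (forall i, 0 <= z i ord0) -> (forall i, 0 <= d i ord0) ->
  (c^T *m x) ord0 ord0 - (c^T *m d) ord0 ord0 <=
  norm2 y * norm2 (M *m x - b) + (z^T *m x) ord0 ord0
  + norm2 (M^T *m y + z - c) * norm2 (x - d).
Proof.
move=> Md z_ge0 d_ge0; set g := M^T *m y + z - c.
have entryD k l (u v : 'M[R]_(k, l)) i j : (u + v) i j = u i j + v i j.
  by rewrite mxE.
have entryN k l (u : 'M[R]_(k, l)) i j : (- u) i j = - u i j by rewrite mxE.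
have cE v : (c^T *m v) ord0 ord0 =
    (y^T *m (M *m v)) ord0 ord0 + (z^T *m v) ord0 ord0
    - (g^T *m v) ord0 ord0.
  rewrite /g !linearD linearN /= trmx_mul trmxK !mulmxDl mulNmx mulmxA.
  by rewrite !entryD entryN; ring.
have -> : (c^T *m x) ord0 ord0 - (c^T *m d) ord0 ord0 =
   (y^T *m (M *m x - b)) ord0 ord0 + (z^T *m x) ord0 ord0
   - (z^T *m d) ord0 ord0 - (g^T *m (x - d)) ord0 ord0.
  by rewrite !cE Md !mulmxBr !entryD !entryN; ring.
have zd_ge0 : 0 <= (z^T *m d) ord0 ord0.
  by rewrite mxE sumr_ge0// => i _; rewrite mxE mulr_ge0.
have := dot_le_norm2 y (M *m x - b); have := dot_le_norm2 g (x - d).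
rewrite !ler_norml => /andP[? _] /andP[_ ?].
lra.
Qed.

Section Blocks.
Variables (R : realType) (S A : finType) (T : nat) (G : mfg R S A T).

Local Notation dimST := (\sum_(t < T.+1) #|S|)%N.
Local Notation dimSAT := (\sum_(t < T.+1) \sum_(a < #|A|) #|S|)%N.

(** The coordinates of the flattened vectors that carry (t, s) and (t, (s, a));
    all block matrices are handled entrywise through them. *)
Definition state_idx (t : 'I_T.+1) (s : S) : 'I_dimST :=
  tagnat.Rank t (enum_rank s).

Definition flow_idx (t : 'I_T.+1) (p : S * A) : 'I_dimSAT :=
  tagnat.Rank t (tagnat.Rank (enum_rank p.2) (enum_rank p.1)).

Lemma sum_state_idx (F : 'I_dimST -> R) :
  \sum_k F k = \sum_t \sum_s F (state_idx t s).
Proof.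
by rewrite sum_Rank; apply: eq_bigr => t _; rewrite sum_enum_rank.
Qed.

Lemma sum_flow_idx (F : 'I_dimSAT -> R) :
  \sum_k F k = \sum_t \sum_p F (flow_idx t p).
Proof.
rewrite sum_Rank; apply: eq_bigr => t _; rewrite sum_Rank sum_enum_rank.
under eq_bigr do rewrite sum_enum_rank.
by rewrite exchange_big pair_big.
Qed.

Lemma flow_idx_surj k : exists t p, k = flow_idx t p.
Proof.
exists (tagnat.sig1 k), (enum_val (tagnat.sig2 (tagnat.sig2 k)),
  enum_val (tagnat.sig1 (tagnat.sig2 k))).
by rewrite /flow_idx !enum_valK !tagnat.sig2K.
Qed.

Lemma flow_ofE (L : 'cV[R]_dimSAT) t p :
  flow_of L t p = L (flow_idx t p) ord0.
Proof. by rewrite /flow_of /unflat ffunE !mxE. Qed.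

Lemma flat_idx (g : S -> A -> R) (p : S * A) :
  flat g (tagnat.Rank (enum_rank p.2) (enum_rank p.1)) ord0 = g p.1 p.2.
Proof. by rewrite /flat mxcol_Rank mxE !enum_rankK. Qed.

Definition flow_vec (d : 'I_T.+1 -> {ffun S * A -> R}) :
    'cV[R]_dimSAT :=
  \mxcol_(t < T.+1) flat (fun s a => d t (s, a)).

Lemma flow_vec_idx d t p : flow_vec d (flow_idx t p) ord0 = d t p.
Proof. by rewrite /flow_vec mxcol_Rank flat_idx; case: p. Qed.

Lemma flow_vecK d : flow_of (flow_vec d) = d.
Proof.
by apply: funext => t; apply/ffunP => p; rewrite flow_ofE flow_vec_idx.
Qed.

Lemma cvec_dot l (x : 'cV[R]_dimSAT) :
  ((cvec G l)^T *m x) ord0 ord0 =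
  - \sum_t \sum_p flow_of x t p * reward G t p.1 p.2 (l t).
Proof.
rewrite mxE sum_flow_idx -sumrN; apply: eq_bigr => t _.
rewrite -sumrN; apply: eq_bigr => p _.
by rewrite mxE /cvec mxcol_Rank flat_idx flow_ofE mulNr mulrC.
Qed.

Lemma Zmx_idx s (p : S * A) :
  Zmx R S A (enum_rank s) (tagnat.Rank (enum_rank p.2) (enum_rank p.1))
  = (p.1 == s)%:R.
Proof.
by rewrite /Zmx mxrow_Rank mxE (inj_eq enum_rank_inj) eq_sym.
Qed.

Lemma Wmx_idx t l s (p : S * A) :
  Wmx G t l (enum_rank s) (tagnat.Rank (enum_rank p.2) (enum_rank p.1))
  = trans G t p.1 p.2 l s.
Proof. by rewrite mxE flat_idx enum_rankK. Qed.

Lemma Amx_idx l t s u p :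
  Amx G l (state_idx t s) (flow_idx u p) =
  if t == ord_max then (if u == ord0 then (p.1 == s)%:R else 0)
  else if u == t then trans G t p.1 p.2 (l t) s
  else if u == t.+1 :> nat then - (p.1 == s)%:R else 0.
Proof.
rewrite /Amx mxblockEv mxcol_Rank mxrow_Rank.
do !case: ifP => _; rewrite ?Zmx_idx ?Wmx_idx//; rewrite [LHS]mxE ?Zmx_idx//.
Qed.

Lemma sum_fst_eq s (F : S * A -> R) :
  \sum_p (p.1 == s)%:R * F p = \sum_a F (s, a).
Proof.
rewrite (eq_bigr (fun p => (p.1 == s)%:R * F (p.1, p.2))); last by case.
rewrite -(pair_bigA _ (fun s' a => (s' == s)%:R * F (s', a))) /=.
rewrite (bigD1 s) //= [X in _ + X]big1 ?addr0 => [|s' /negPf ns].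
  by apply: eq_bigr => a _; rewrite eqxx mul1r.
by apply: big1 => a _; rewrite ns mul0r.
Qed.

Lemma constraint_idx l x t s :
  (Amx G l *m x - bvec G) (state_idx t s) ord0 =
  \sum_u \sum_p Amx G l (state_idx t s) (flow_idx u p) * flow_of x u p
  - (if t == ord_max then init G s else 0).
Proof.
rewrite [LHS]mxE [X in _ + X]mxE /bvec mxcol_Rank mxE sum_flow_idx.
congr (_ - _); last by case: ifP => _; rewrite mxE ?enum_rankK.
by apply: eq_bigr => u _; apply: eq_bigr => p _; rewrite flow_ofE.
Qed.

Lemma constraint_initial l x s :
  (Amx G l *m x - bvec G) (state_idx ord_max s) ord0
  = mass (flow_of x ord0) s - init G s.
Proof.
rewrite constraint_idx eqxx; congr (_ - _).
rewrite (bigD1 ord0) //= [X in _ + X]big1 ?addr0; last first.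
  move=> u /negPf nu; apply: big1 => p _.
  by rewrite Amx_idx eqxx nu mul0r.
under eq_bigr do rewrite Amx_idx !eqxx.
exact: sum_fst_eq.
Qed.

Lemma constraint_step l x s n : (n < T)%N ->
  (Amx G l *m x - bvec G) (state_idx (inord n) s) ord0
  = \sum_q flow_of x (inord n) q * trans G (inord n) q.1 q.2 (l (inord n)) s
    - mass (flow_of x (inord n.+1)) s.
Proof.
move=> nT.
have n_max : (inord n == ord_max :> 'I_T.+1) = false.
  by rewrite -val_eqE /= inordK ?ltn_eqF// ltnW.
have nSn : (inord n.+1 == inord n :> 'I_T.+1) = false.
  by rewrite -val_eqE /= !inordK ?gtn_eqF// ltnW.
rewrite constraint_idx n_max subr0 (bigD1 (inord n)) //=.
rewrite [X in _ + X](bigD1 (inord n.+1)) ?nSn//=.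
rewrite [X in _ + (_ + X)]big1 ?addr0; last first.
  move=> u /andP[/negPf nu nu1]; apply: big1 => p _.
  rewrite Amx_idx n_max nu (inordK (ltnW nT)) ifN ?mul0r//.
  by apply: contra nu1 => /eqP un; rewrite -val_eqE /= inordK ?un.
congr (_ + _).
  by apply: eq_bigr => q _; rewrite Amx_idx n_max eqxx mulrC.
rewrite -[mass _ _]sum_fst_eq -sumrN; apply: eq_bigr => p _.
by rewrite Amx_idx n_max nSn !inordK ?eqxx ?mulNr// ltnW.
Qed.

Lemma flow_of_is_flow (L : 'cV[R]_dimSAT) :
  (forall i, 0 <= L i ord0) ->
  (forall t, \sum_i time_block L t i ord0 = 1) -> is_flow (flow_of L).
Proof.
move=> L_ge0 L1 t; split=> [p|]; first by rewrite flow_ofE.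
rewrite -(L1 t) sum_Rank sum_enum_rank.
under [RHS]eq_bigr do rewrite sum_enum_rank.
rewrite exchange_big pair_big /=; apply: eq_bigr => p _.
by rewrite flow_ofE [RHS]mxE.
Qed.

(** Occupation measures of the decision process of [L] are exactly feasible:
    flow conservation is their defining recursion. *)
Lemma occupation_feasible pi L : is_policy pi -> is_flow L ->
  Amx G L *m flow_vec (fun t => occupation G pi L t) = bvec G.
Proof.
move=> piP LP; apply/eqP; rewrite -subr_eq0; apply/eqP/colP => k.
rewrite [RHS]mxE -(tagnat.sig2K k) -(enum_valK (tagnat.sig2 k)).
rewrite -[tagnat.Rank _ _]/(state_idx (tagnat.sig1 k) (enum_val _)).
move: (enum_val _) => s; move: (tagnat.sig1 k) => t {k}.
have mass_policy t' (m : S -> R) :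
    mass [ffun p => pi t' p.1 p.2 * m p.1] s = m s.
  rewrite /mass; under eq_bigr do rewrite ffunE /=.
  by rewrite -mulr_suml (simplex_sum (piP t' s)) mul1r.
have [->|] := eqVneq t ord_max.
  by rewrite constraint_initial flow_vecK /= mass_policy subrr.
rewrite -val_eqE /= => t_max.
have tT : (t < T)%N by rewrite ltn_neqAle t_max /= -ltnS.
rewrite -(inord_val t) constraint_step// flow_vecK !inordK ?ltnS//.
  rewrite /= (mass_policy _ (fun s => \sum_q _ q * trans G _ q.1 q.2 _ s)).
  by rewrite subrr.
exact: ltnW.
Qed.

Lemma constraint_l1 (v : 'cV[R]_dimST) t :
  \sum_s `|v (state_idx t s) ord0| <= Num.sqrt #|S|%:R * norm2 v.
Proof.
apply: le_trans (l1_le_l2 _) _; apply: (ler_wpM2l (sqrtr_ge0 _)).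
apply: ler_wsqrtr; rewrite sum_state_idx [leRHS](bigD1 t) //= lerDl.
by apply: sumr_ge0 => u _; apply: sumr_ge0 => s _; apply: sqr_ge0.
Qed.

(** All entries of the difference of two flows lie in [-1, 1]. *)
Lemma norm2_flowB (x y : 'cV[R]_dimSAT) :
  is_flow (flow_of x) -> is_flow (flow_of y) ->
  norm2 (x - y) <= Num.sqrt (#|S| * #|A| * T.+1)%:R.
Proof.
move=> xP yP; apply: ler_wsqrtr; rewrite sum_flow_idx.
apply: (@le_trans _ _ (\sum_(t < T.+1) \sum_(p : S * A) 1)).
  apply: ler_sum => t _; apply: ler_sum => p _.
  rewrite 2!mxE -!flow_ofE.
  have := simplex_ge0 p (xP t); have := simplex_le1 p (xP t).
  have := simplex_ge0 p (yP t); have := simplex_le1 p (yP t).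
  by rewrite expr2; nra.
by rewrite !sumr_const card_ord card_prod -mulrnA.
Qed.

End Blocks.

(** * The exploitability bound *)

Theorem theorem8 (R : realType) (S A : finType) (T : nat) (G : mfg R S A T)
  (C_P C_r : R) (C_P_gt0 : 0 < C_P) (C_r_gt0 : 0 < C_r)
  (trans_lipschitz : forall (t : 'I_T.+1) (L1 L2 : 'I_T.+1 -> {ffun S * A -> R}),
     is_flow L1 -> is_flow L2 ->
     \big[Num.max/0]_(p : S * A)
       \sum_(s' : S) `|trans G t p.1 p.2 (L1 t) s' - trans G t p.1 p.2 (L2 t) s'|
     <= C_P * dist1 (L1 t) (L2 t))
  (reward_lipschitz : forall (t : 'I_T.+1) (L1 L2 : 'I_T.+1 -> {ffun S * A -> R}),
     is_flow L1 -> is_flow L2 ->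
     \big[Num.max/0]_(p : S * A)
       `|reward G t p.1 p.2 (L1 t) - reward G t p.1 p.2 (L2 t)|
     <= C_r * dist1 (L1 t) (L2 t))
  (y : 'cV[R]_(\sum_(t < T.+1) #|S|))
  (z L : 'cV[R]_(\sum_(t < T.+1) \sum_(a < #|A|) #|S|))
  (feasible : mfomo_feasible G y z L)
  (eps : R) (eps_ge0 : 0 <= eps)
  (objective_le : mfomo_objective G y z L <= eps ^+ 2)
  (pi : 'I_T.+1 -> S -> {ffun A -> R}) (pi_in : flow_policies (flow_of L) pi) :
  exploitability G pi
    <= expl_const #|S| #|A| T C_P C_r (rmax G) * eps + eps ^+ 2.
Proof.
have trans_lip t s a l1 l2 :
    simplex (S * A)%type l1 -> simplex (S * A)%type l2 ->
    dist1 (trans G t s a l1) (trans G t s a l2) <= C_P * dist1 l1 l2.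
  move=> l1P l2P.
  apply: le_trans (trans_lipschitz t (fun=> l1) (fun=> l2) _ _) => //.
  exact: (le_bigmax _ (fun p : S * A =>
    dist1 (trans G t p.1 p.2 l1) (trans G t p.1 p.2 l2)) (s, a)).
have reward_lip t s a l1 l2 :
    simplex (S * A)%type l1 -> simplex (S * A)%type l2 ->
    `|reward G t s a l1 - reward G t s a l2| <= C_r * dist1 l1 l2.
  move=> l1P l2P.
  apply: le_trans (reward_lipschitz t (fun=> l1) (fun=> l2) _ _) => //.
  exact: (le_bigmax _ (fun p : S * A =>
    `|reward G t p.1 p.2 l1 - reward G t p.1 p.2 l2|) (s, a)).
case: feasible => L_ge0 L_sum1 z_ge0 _ y_le.
have LP := flow_of_is_flow L_ge0 L_sum1.
have r_ge0 := rmax_ge0 G (LP ord0).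
move: objective_le; rewrite /mfomo_objective.
set res := Amx G _ *m L - _; set g := _ + z - _.
set zL := (z^T *m L) _ _ => obj.
have zL_ge0 : 0 <= zL.
  by rewrite /zL mxE sumr_ge0// => i _; rewrite mxE mulr_ge0.
have res_le : norm2 res <= eps.
  rewrite -(ler_pXn2r (n := 2)) ?nnegrE ?norm2_ge0//.
  by have := sqr_ge0 (norm2 g); lra.
have g_le : norm2 g <= eps.
  rewrite -(ler_pXn2r (n := 2)) ?nnegrE ?norm2_ge0//.
  by have := sqr_ge0 (norm2 res); lra.
have zL_le : zL <= eps ^+ 2.
  by have := sqr_ge0 (norm2 g); have := sqr_ge0 (norm2 res); lra.
set sS := Num.sqrt #|S|%:R : R; set sSA := Num.sqrt (#|S| * #|A| * T.+1)%:R : R.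
have eta_ge0 : 0 <= sS * eps by rewrite mulr_ge0 ?sqrtr_ge0.
have res_l1 t : \sum_s `|res (state_idx t s) ord0| <= sS * eps.
  apply: le_trans (constraint_l1 _ _) _.
  exact: (ler_wpM2l (sqrtr_ge0 _) res_le).
(* [L] nearly minimises the linear program of which every occupation measure
   is a feasible point; its objective is minus the payoff. *)
have gap pi' : is_policy pi' ->
  value G pi' (flow_of L) - flow_payoff G (flow_of L) <=
    (#|S| * T.+1 * T.+2)%:R / 2 * rmax G * eps + eps ^+ 2 + eps * sSA.
  move=> pi'P.
  pose d : 'I_T.+1 -> {ffun S * A -> R} :=
    fun t => occupation G pi' (flow_of L) t.
  have dP : is_flow d by move=> t; apply: occupation_simplex.
  have d_ge0 i : 0 <= flow_vec d i ord0.
    have [t [p ->]] := flow_idx_surj i.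
    by rewrite flow_vec_idx; apply: simplex_ge0.
  have := lp_gap y (cvec G (flow_of L)) L
    (occupation_feasible G pi'P LP) z_ge0 d_ge0.
  rewrite !cvec_dot flow_vecK opprK addrC -/g -/res -/zL.
  rewrite -(value_occupation G pi'P LP) => /le_trans; apply.
  rewrite lerD ?lerD//; last first.
  - apply: ler_pM => //; rewrite ?norm2_ge0//.
    by apply: norm2_flowB; rewrite ?flow_vecK.
  - by apply: ler_pM; rewrite ?norm2_ge0.
have := exploitability_le_residual C_P_gt0 C_r_gt0 trans_lip reward_lip LP
  pi_in eta_ge0 _ _ gap.
move=> /(_ _ _)/le_trans; apply.
- apply: le_trans (res_l1 ord_max); apply: ler_sum => s _.
  by rewrite constraint_initial.
- move=> n nT; apply: le_trans (res_l1 (inord n)); apply: ler_sum => s _.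
  by rewrite constraint_step.
rewrite sum_growth// /expl_const -/sS -/sSA.
have growthT : C_P * growth C_P T = (C_P + 1) ^+ T.+1 - 1.
  by rewrite /growth mulrC divfK// gt_eqF.
rewrite growthT.
have [[s a] _] := simplex_inhabited (LP ord0).
have sS_ge1 : 1 <= sS.
  by rewrite -sqrtr1 ler_wsqrtr// ler1n; apply/card_gt0P; exists s.
have A_ge1 : 1 <= #|A|%:R :> R by rewrite ler1n; apply/card_gt0P; exists a.
have card_SE : #|S|%:R = sS ^+ 2 by rewrite sqr_sqrtr.
rewrite -mulnA !natrM card_SE.
have T1_ge1 : 1 <= T.+1%:R :> R by rewrite ler1n.
have T2E : T.+2%:R = T.+1%:R + 1 :> R by rewrite natr1.
(* Since sS = sqrt |S| >= 1, the cubic term absorbs two contributions: the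
   accumulated residuals in the comparison of the payoff of [flow_of L] with the
   value of [pi], and the product of the bound on [y] with eps. *)
have lower_order :
    sS * (T.+1%:R * T.+2%:R / 2) + sS ^+ 2 * (T.+1%:R * T.+2%:R) / 2
    <= sS ^+ 3 * #|A|%:R * T.+2%:R ^+ 3.
  have sS_cube : (sS + sS ^+ 2) / 2 <= sS ^+ 3.
    have := ler_weXn2l sS_ge1 (isT : 1 <= 3)%N.
    by have := ler_weXn2l sS_ge1 (isT : 2 <= 3)%N; rewrite expr1; lra.
  have T_cube : T.+1%:R * T.+2%:R <= T.+2%:R ^+ 3 :> R.
    by rewrite T2E !exprS expr0 mulr1; nra.
  have : (sS + sS ^+ 2) / 2 * (T.+1%:R * T.+2%:R) <=
      sS ^+ 3 * T.+2%:R ^+ 3 * #|A|%:R.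
    apply: le_trans (ler_peMr _ A_ge1); last first.
      by rewrite mulr_ge0 ?exprn_ge0 ?sqrtr_ge0.
    apply: ler_pM => //; last by rewrite mulr_ge0.
    by rewrite divr_ge0// addr_ge0 ?exprn_ge0 ?sqrtr_ge0.
  lra.
have := ler_wpM2l (mulr_ge0 r_ge0 eps_ge0) lower_order.
have := mulr_ge0 (sqrtr_ge0 (T%:R : R)) eps_ge0.
lra.
Qed.
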